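(* Consider the continuous-time finite single-hop network with $N$ queues and utility-maximising service rates described in the context, and assume that there exists $\bar\nu\in\mathcal{C}$ such that $\lambda_i<\nu_i$ for all $i$. Then the Markov process $\{\bar X(t)\}_{t\ge0}$ is stable (positive recurrent).
   Context: Model. There are $N<\infty$ queues with state $\bar X(t)=(X_1(t),\dots,X_N(t))\in\mathbb{Z}_+^N$. Arrivals to queue $i$ form a Poisson process of constant rate $\lambda_i$, independent of all other processes. The instantaneous departure rate from queue $i$ at time $t$, given $\bar X(t)$, is $\psi_i(\bar X(t))$: the number of departures from queue $i$ up to time $t$ is $\Pi_i\bigl(\int_0^t\psi_i(\bar X(\tau))\,d\tau\bigr)$, where $\Pi_i$ are independent unit-rate Poisson processes. The process is a countable-state Markov process, assumed irreducible. Service rates. It is assumed that $\psi_i(\bar x)\in[0,1]$, that $\psi_i(\bar x)=0$ if $x_i=0$, and that for every $\bar x$ $$\bar\psi(\bar x)\in\arg\max_{\bar\mu\in\mathcal{C}}\ \sum_i g(x_i)h(\mu_i),$$ where $\mathcal{C}\subset\mathbb{R}_+^N$ is compact and coordinate-convex (if $\bar\mu\in\mathcal{C}$ and $0\le\bar\mu^*\le\bar\mu$ coordinate-wise, then $\bar\mu^*\in\mathcal{C}$); $\mathcal{C}$ is not assumed convex. The convention $0\cdot(-\infty)=0$ is used. Condition on $h$: $h:[0,\infty)\to\mathbb{R}$ is strictly increasing, differentiable and concave, where both $\lim_{y\downarrow0}h(y)=h(0)>-\infty$ and $\lim_{y\downarrow 0}h(y)=-\infty$ (with $h(0)=-\infty$)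 are allowed. Condition on $g$: $g:\mathbb{Z}_+\to[0,\infty)$ is strictly increasing and $g(y)/\Delta(y)\to\infty$ as $y\to\infty$, where $\Delta(y)=g(y+1)-g(y)$ (equivalently $g(y+1)/g(y)\to1$).
   Formalization: The formal theorem additionally assumes g(y) → ∞ as y → ∞; for bounded g satisfying the stated condition the claim fails (e.g. two queues, C a quarter disk, h = log, g(0)=0, g(y)=1+0.01(1−1/y), λ=(0.83,0.5)). *)

(* Defs.v *)
From HB Require Import structures.
From mathcomp Require Import all_boot all_order all_algebra.
From mathcomp Require Import all_classical all_reals all_analysis.

Set Implicit Arguments.
Unset Strict Implicit.
Unset Printing Implicit Defensive.
Import Order.TTheory GRing.Theory Num.Theory.
Import numFieldNormedType.Exports.
Local Open Scope classical_set_scope.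
Local Open Scope ring_scope.

(* Time is [0, +oo[: a process is indexed by R, but only its values at
   nonnegative times are ever constrained or used. *)

Definition state (N : nat) : Type := {ffun 'I_N -> nat}.

Section Processes.
Context {R : realType} {d : measure_display} {T : measurableType d}.

Definition counting_path (a : R -> nat) : Prop :=
  [/\ a 0 = 0%N,
      (forall s t, 0 <= s -> s <= t -> (a s <= a t)%N)
    & (forall t, 0 <= t -> \forall s \near t^'+, a s = a t)].

(* Written out because the library's poisson_pmf is the constant 1 at rate 0,
   whereas zero-length increments and zero arrival rates occur here. *)
Definition poisson_weight (r : R) (k : nat) : R :=
  r ^+ k / k`!%:R * expR (- r).

Definition is_poisson_process (P : probability T R) (rate : R)
    (A : R -> T -> nat) : Prop :=
  [/\ (forall t k, 0 <= t -> measurable [set w | A t w = k]),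
      {ae P, forall w, counting_path (A ^~ w)}
    & (forall (m : nat) (t : nat -> R) (k : nat -> nat),
         0 <= t 0%N -> (forall j, t j <= t j.+1) ->
         P [set w | forall j, (j < m)%N ->
                      A (t j.+1) w = (A (t j) w + k j)%N]
         = (\prod_(j < m)
              poisson_weight (rate * (t j.+1 - t j)) (k j))%:E)].

(* Mutual independence through finite-dimensional distributions.  The processes
   being nat-valued, singletons determine these laws, and the product rule for
   subfamilies follows from the full one by summing over the other values. *)
Definition independent_processes (I : finType) (P : probability T R)
    (A : I -> R -> T -> nat) : Prop :=
  forall (m : nat) (t : I -> 'I_m -> R) (k : I -> 'I_m -> nat),
    (forall i j, 0 <= t i j) ->
    P [set w | forall i j, A i (t i j) w = k i j]
    = (\prod_(i : I) P [set w | forall j, A i (t i j) w = k i j])%E.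

Context {N : nat}.

(* A Markov process is a process X together with a family of probabilities,
   P x being the law under which X starts from x. *)
Definition markov_process (P : state N -> probability T R)
    (X : R -> T -> state N) : Prop :=
  [/\ (forall t y, 0 <= t -> measurable [set w | X t w = y]),
      (forall x, {ae P x, forall w, X 0 w = x})
    & (forall x (m : nat) (t : nat -> R) (y : nat -> state N) (s : R) z,
         0 <= t 0%N -> (forall j, t j <= t j.+1) -> 0 <= s ->
         P x [set w | (forall j, (j <= m)%N -> X (t j) w = y j) /\
                      X (t m + s) w = z]
         = (P x [set w | forall j, (j <= m)%N -> X (t j) w = y j]
            * P (y m) [set w | X s w = z])%E)].

Definition irreducible_process (P : state N -> probability T R)
    (X : R -> T -> state N) : Prop :=
  forall x y, exists2 t, 0 <= t & (0 < P x [set w | X t w = y])%E.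

(* First time at which X is in x after having been outside x; it is +oo when
   there is no such time. *)
Definition return_time (X : R -> T -> state N) (x : state N) (w : T) : \bar R :=
  ereal_inf [set t%:E | t in
    [set t : R | exists s, [/\ 0 <= s, s <= t, X s w <> x & X t w = x]]].

Definition positive_recurrent (P : state N -> probability T R)
    (X : R -> T -> state N) : Prop :=
  forall x, (\int[P x]_w return_time X x w < +oo)%E.

(* Arr i counts the arrivals to queue i; Srv i is the unit-rate Poisson process
   which, run at the cumulative service rate, counts the departures. *)
Definition queueing_network (lambda : 'I_N -> R) (psi : state N -> 'rV[R]_N)
    (P : state N -> probability T R) (Arr Srv : 'I_N -> R -> T -> nat)
    (X : R -> T -> state N) : Prop :=
  forall x,
    [/\ (forall i, is_poisson_process (P x) (lambda i) (Arr i)),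
        (forall i, is_poisson_process (P x) 1 (Srv i)),
        independent_processes (P x)
          (fun c : 'I_N + 'I_N =>
             match c with inl i => Arr i | inr i => Srv i end)
      & {ae P x, forall w t i, 0 <= t ->
          (X t w i)%:Z = (X 0 w i)%:Z + (Arr i t w)%:Z
            - (Srv i (\int[lebesgue_measure]_(u in `[0, t]) psi (X u w) 0 i)
                     w)%:Z}].

End Processes.

Section Service.
Context {R : realType} {N : nat}.

Definition coordinate_convex (C : set 'rV[R]_N) : Prop :=
  (forall mu, C mu -> forall i, 0 <= mu 0 i) /\
  (forall mu mu' : 'rV[R]_N, C mu ->
     (forall i, 0 <= mu' 0 i /\ mu' 0 i <= mu 0 i) -> C mu').

(* h is used on [0, +oo[ only and takes the value -oo at most at 0.
   Differentiability is required on ]0, +oo[ only, so that functions with an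
   infinite slope at 0 are included. *)
Definition service_utility (h : R -> \bar R) : Prop :=
  [/\ (forall y, 0 < y -> h y \is a fin_num),
      (forall y z, 0 <= y -> y < z -> (h y < h z)%E),
      (forall y, 0 < y -> derivable (fun z => fine (h z)) y 1),
      (forall y z t, 0 <= y -> 0 <= z -> 0 <= t -> t <= 1 ->
         (t%:E * h y + (1 - t)%:E * h z <= h (t * y + (1 - t) * z)%R)%E)
    & h y @[y --> 0^'+] --> h 0].

(* Bounded functions are not excluded: g n = n / (n + 1) is one. *)
Definition queue_weight (g : nat -> R) : Prop :=
  [/\ (forall n, 0 <= g n),
      (forall n, g n < g n.+1)
    & (fun n => g n / (g n.+1 - g n)) @ \oo --> +oo].

(* The library's product on \bar R satisfies 0 * -oo = 0. *)
Definition network_utility (g : nat -> R) (h : R -> \bar R) (x : state N)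
    (mu : 'rV[R]_N) : \bar R :=
  (\sum_(i < N) (g (x i))%:E * h (mu 0%R i))%E.

Definition utility_maximising (C : set 'rV[R]_N) (g : nat -> R)
    (h : R -> \bar R) (psi : state N -> 'rV[R]_N) : Prop :=
  forall x, [/\ C (psi x),
    (forall mu, C mu ->
       (network_utility g h x mu <= network_utility g h x (psi x))%E),
    (forall i, 0 <= psi x 0 i /\ psi x 0 i <= 1)
  & (forall i, x i = 0%N -> psi x 0 i = 0)].

End Service.

(* Main.v *)
Require Import Defs.
From HB Require Import structures.
From mathcomp Require Import all_boot all_order all_algebra.
From mathcomp Require Import all_classical all_reals all_analysis.
From mathcomp Require Import measurable_realfun ring lra.
Import Order.TTheory GRing.Theory Num.Theory.
Import numFieldNormedType.Exports.
Local Open Scope classical_set_scope.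
Local Open Scope ring_scope.

(* Concavity of [h] gives supergradients [c i > 0] at [nu i], and optimality of
   [psi x] against [nu] becomes the linear inequality
   [sum_i g (x i) c_i nu_i <= sum_i g (x i) c_i psi_i].  Hence
   [V x = sum_i c_i (g 0 + ... + g (x i - 1))] has drift at most
   [- eps sum_i c_i g (x i) + const].  The drift is not computed from a generator
   but over one step of the skeleton chain [X (n t)] with [t] small: on the event
   that no arrival occurs before [t], no other clock rings before [t] and clock
   [i] rings exactly once before [psi_i t], queue [i] has lost a customer by time
   [t]; otherwise queue lengths exceed their initial values by at most the number
   of arrivals.  Only the laws of the clocks at fixed times enter, so no path
   regularity is needed beyond monotonicity of the counting paths.  Finally the
   Foster criterion is applied to the skeleton chain, whose return times dominate
   those of [X]. *)

(** * Integrals, almost sure inclusions and countable-valued maps *)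

Section LowerIntegral.
Context {d : measure_display} {T : measurableType d} {R : realType}.
Variable mu : {measure set T -> \bar R}.
Local Open Scope ereal_scope.

(* The integral of a nonnegative function is the supremum of the integrals of
   the simple functions below it, so monotonicity needs no measurability. *)
Lemma ge0_le_integral_nonmeas (D E : set T) (f1 f2 : T -> \bar R) :
  (forall x, D x -> 0 <= f1 x) -> (forall x, E x -> 0 <= f2 x) ->
  (forall x, D x -> E x /\ f1 x <= f2 x) ->
  \int[mu]_(x in D) f1 x <= \int[mu]_(x in E) f2 x.
Proof.
move=> f10 f20 f12; rewrite !ge0_integralE//.
apply: le_ereal_sup => _ [h hf <-]; exists h => // x.
apply: le_trans (hf x) _; rewrite !patchE.
case: ifPn => [/set_mem Dx|_]; first by have [Ex ?] := f12 x Dx; rewrite mem_set.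
by case: ifPn => // /set_mem; exact: f20.
Qed.

End LowerIntegral.

Section AlmostEverywhere.
Context {d : measure_display} {T : measurableType d} {R : realType}.
Variable mu : {measure set T -> \bar R}.
Local Open Scope ereal_scope.

Lemma ae_le_measure (A B : set T) : measurable A -> measurable B ->
  {ae mu, forall w, A w -> B w} -> mu A <= mu B.
Proof.
move=> mA mB [M [mM M0 AB]].
apply: (@le_trans _ _ (mu (B `|` M))).
  apply: le_measure; rewrite ?inE//; first exact: measurableU.
  move=> w Aw; have [Bw|nB] := pselect (B w); first by left.
  by right; apply: AB => /(_ Aw).
by rewrite -[leRHS]adde0 -M0; exact: measureU2.
Qed.

Lemma ae_eq_measure (A B : set T) : measurable A -> measurable B ->
  {ae mu, forall w, A w <-> B w} -> mu A = mu B.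
Proof.
move=> mA mB AB; apply/eqP; rewrite eq_le; apply/andP.
by split; apply: ae_le_measure => //; apply: filterS AB => w [].
Qed.

End AlmostEverywhere.

Section CountableValued.
Context {d : measure_display} {T : measurableType d} {R : realType}.
Variable mu : {measure set T -> \bar R}.
Context {K : countType} {Z : T -> K}.
Hypothesis mZ : forall k, measurable [set w | Z w = k].
Local Open Scope ereal_scope.

Lemma measurable_preimage_countable (A : set K) : measurable [set w | A (Z w)].
Proof.
rewrite (_ : [set w | _] = \bigcup_(n in [set: nat])
   [set w | exists2 k, unpickle n = Some k & A k /\ Z w = k]); last first.
  apply/seteqP; split => w /=.
    by move=> AZ; exists (pickle (Z w)) => //=; exists (Z w); rewrite ?pickleK.
  by move=> [n _ [k _ [Ak ->]]].
apply: bigcup_measurable => n _.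
case: (unpickle n) => [k|]; last first.
  by rewrite (_ : [set _ | _] = set0)//; apply/seteqP; split => w //= [].
have [Ak|nAk] := pselect (A k).
  rewrite (_ : [set _ | _] = [set w | Z w = k])//; apply/seteqP.
  by split=> w /= => [[_ [<-] []//]|?]; exists k.
rewrite (_ : [set _ | _] = set0)//; apply/seteqP; split => w //=.
by case=> _ [<-] [].
Qed.

Lemma measurable_fun_countable (f : K -> \bar R) D :
  measurable_fun D (fun w => f (Z w)).
Proof.
move=> mD B mB; apply: measurableI => //.
exact: (measurable_preimage_countable [set k | B (f k)]).
Qed.

(** Conditioning on the discrete variable [Z]. Fibres are labelled by codes in [nat] so that
    countable additivity applies; a number that codes no element gives an empty fibre. *)
Lemma ge0_integral_fibers (E : set T) (f : T -> \bar R) :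
  measurable E -> measurable_fun setT f -> (forall w, 0 <= f w) ->
  \int[mu]_(w in E) f w =
  \sum_(n <oo) \int[mu]_(w in E `&` [set w | pickle (Z w) = n]) f w.
Proof.
move=> mE mf f0; rewrite -ge0_integral_bigcup//=.
- congr (integral _ _ _); apply/seteqP; split => w /=.
    by move=> Ew; exists (pickle (Z w)).
  by case=> n _ [].
- move=> n; apply: measurableI => //.
  exact: (measurable_preimage_countable [set k | pickle k = n]).
- exact: measurable_funTS.
- apply/trivIsetP => i j _ _ /eqP ij; apply/seteqP; split => w //=.
  by move=> [[_ Zi] [_ Zj]]; apply: ij; rewrite -Zi -Zj.
Qed.

End CountableValued.

(** * A Foster criterion for countable Markov chains *)

Section MarkovChain.
Context {d : measure_display} {T : measurableType d} {R : realType}.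
Context {S : countType} (P : S -> probability T R) (Y : nat -> T -> S).
Hypothesis mY : forall n y, measurable [set w | Y n w = y].
Hypothesis Y0 : forall x, {ae P x, forall w, Y 0%N w = x}.
Hypothesis Y_last : forall x n (c : nat -> S) z,
  P x [set w | (forall j, (j <= n)%N -> Y j w = c j) /\ Y n.+1 w = z]
  = (P x [set w | forall j, (j <= n)%N -> Y j w = c j]
     * P (c n) [set w | Y 1%N w = z])%E.
Hypothesis Y_first : forall x n z y,
  P x [set w | Y 1%N w = z /\ Y n.+1 w = y]
  = (P x [set w | Y 1%N w = z] * P z [set w | Y n w = y])%E.
Local Open Scope ereal_scope.

(** The transition operator of the chain. It acts on extended-real functions, so that it can be
    iterated before any finiteness is known. *)
Definition step (f : S -> \bar R) (y : S) : \bar R := \int[P y]_w f (Y 1%N w).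

Let mfY n (f : S -> \bar R) D : measurable_fun D (fun w => f (Y n w)).
Proof. exact: measurable_fun_countable. Qed.

Lemma le_step (f g : S -> \bar R) y :
  (forall z, 0 <= f z) -> (forall z, f z <= g z) -> step f y <= step g y.
Proof. by move=> f0 fg; apply: ge0_le_integral. Qed.

Lemma step_ge0 (f : S -> \bar R) y : (forall z, 0 <= f z) -> 0 <= step f y.
Proof. by move=> f0; apply: integral_ge0. Qed.

Lemma stepD (f g : S -> \bar R) y :
  (forall z, 0 <= f z) -> (forall z, 0 <= g z) ->
  step (fun z => f z + g z) y = step f y + step g y.
Proof. by move=> f0 g0; rewrite /step ge0_integralD. Qed.

Lemma stepZ (k : R) (f : S -> \bar R) y : (0 <= k)%R -> (forall z, 0 <= f z) ->
  step (fun z => k%:E * f z) y = k%:E * step f y.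
Proof. by move=> k0 f0; rewrite /step ge0_integralZl_EFin. Qed.

Lemma step_cst (k : \bar R) y : step (fun=> k) y = k.
Proof.
by rewrite /step integral_cst// [X in _ * X]probability_setT mule1.
Qed.

(** The integrated form of [Y_last]: both integrals split over the value of the next state, and
    [Y_last] matches them term by term. *)
Lemma ge0_integral_cell x n (c : nat -> S) (f : S -> \bar R) :
  (forall z, 0 <= f z) ->
  let H := [set w | forall j, (j <= n)%N -> Y j w = c j] in
  measurable H ->
  \int[P x]_(w in H) f (Y n.+1 w) = P x H * step f (c n).
Proof.
move=> f0 H mH.
rewrite (ge0_integral_fibers (P x) (mY n.+1))//.
rewrite /step (ge0_integral_fibers (P (c n)) (mY 1))//.
have PH : P x H \is a fin_num by rewrite fin_num_measure.
rewrite -(fineK PH) -nneseriesZl; last by move=> i _; exact: integral_ge0.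
apply: eq_eseriesr => k _; rewrite fineK// setTI.
have [[z zk]|nz] := pselect (exists z : S, pickle z = k); last first.
  rewrite [X in integral _ X]( _ : _ = set0); last first.
    by apply/seteqP; split => w //= [_ ?]; apply: nz; exists (Y n.+1 w).
  rewrite [X in _ = _ * integral _ X _]( _ : _ = set0); last first.
    by apply/seteqP; split => w //= ?; apply: nz; exists (Y 1%N w).
  by rewrite !integral_set0 mule0.
have pk w' : pickle w' = k -> w' = z :> S.
  by rewrite -zk => /(pcan_inj (@pickleK _)).
rewrite [X in integral _ X](_ : _ = [set w | H w /\ Y n.+1 w = z]); last first.
  by apply/seteqP; split => w /= [Hw]; [move/pk|move=> ->].
rewrite [X in _ = _ * integral _ X _](_ : _ = [set w | Y 1%N w = z]); last first.
  by apply/seteqP; split => w /=; [move/pk|move=> ->].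
rewrite (eq_integral (cst (f z))); last by move=> w /set_mem [_ /= ->].
rewrite integral_cst; last exact: (measurableI H [set w | Y n.+1 w = z]).
rewrite [in RHS](eq_integral (cst (f z))); last by move=> w /set_mem /= ->.
by rewrite integral_cst// [X in _ * X = _](Y_last x n c z) [RHS]muleCA.
Qed.

(** Averaging over the next state given the past. The second hypothesis makes [E] an event of the
    first [n + 1] states; there are countably many histories, and each one is a cell for
    [ge0_integral_cell]. *)
Lemma ge0_integral_history x n (E : set T) (f : S -> S -> \bar R) :
  (forall y z, 0 <= f y z) ->
  (forall w w', (forall j, (j <= n)%N -> Y j w = Y j w') -> E w -> E w') ->
  \int[P x]_(w in E) f (Y n w) (Y n.+1 w)
  = \int[P x]_(w in E) step (f (Y n w)) (Y n w).
Proof.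
move=> f0 EH; pose H w := [ffun j : 'I_n.+1 => Y j w].
have mH c : measurable [set w | H w = c].
  rewrite (_ : [set _ | _] = \bigcap_(j in [set: 'I_n.+1]) [set w | Y j w = c j]).
    by apply: fin_bigcap_measurable => // j _.
  apply/seteqP; split => w /= => [<- j _|Hw]; first by rewrite ffunE.
  by apply/ffunP => j; rewrite ffunE Hw.
have HE w w' : H w = H w' -> E w -> E w'.
  move=> Hw; apply: EH => j jn.
  by move/ffunP: Hw => /(_ (Ordinal (jn : (j < n.+1)%N))); rewrite !ffunE.
have mE : measurable E.
  rewrite (_ : E = [set w | [set c | exists2 w, E w & H w = c] (H w)]).
    exact: measurable_preimage_countable.
  by apply/seteqP; split => w /= => [Ew|[w' Ew' /HE]]; [exists w|exact].
have mf2 (g : S -> S -> \bar R) : measurable_fun setT (fun w => g (Y n w) (Y n.+1 w)).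
  apply: (@measurable_fun_countable _ _ R _ (fun w => (Y n w, Y n.+1 w)) _
           (fun p => g p.1 p.2)) => -[y z].
  rewrite (_ : [set _ | _] = [set w | Y n w = y] `&` [set w | Y n.+1 w = z]).
    exact: measurableI.
  by apply/seteqP; split => w /= [-> ->].
rewrite (ge0_integral_fibers (P x) mH)//.
rewrite [RHS](ge0_integral_fibers (P x) mH)//; last first.
- by move=> w; exact: step_ge0.
- exact: (mf2 (fun y _ => step (f y) y)).
apply: eq_eseriesr => k _.
have [[w0 [Ew0 w0k]]|nw] := pselect (exists w0, E w0 /\ pickle (H w0) = k); last first.
  rewrite ( _ : _ `&` _ = set0) ?integral_set0//.
  by apply/seteqP; split => w //= [? ?]; apply: nw; exists w.
rewrite (_ : _ `&` _ = [set w | forall j, (j <= n)%N -> Y j w = Y j w0]); last first.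
  apply/seteqP; split => w /=.
    rewrite -w0k => -[Ew /(pcan_inj (@pickleK _))/ffunP Hw] j jn.
    by move: (Hw (Ordinal (jn : (j < n.+1)%N))); rewrite !ffunE.
  move=> Hw; split; first by apply: EH Ew0 => j /Hw.
  by rewrite -w0k; congr pickle; apply/ffunP => j; rewrite !ffunE Hw// -ltnS.
set C := [set w | _].
have mC : measurable C.
  rewrite (_ : C = [set w | H w = H w0])//; apply/seteqP; split => w /=.
    by move=> Hw; apply/ffunP => j; rewrite !ffunE Hw// -ltnS.
  move=> /ffunP Hw j jn.
  by move: (Hw (Ordinal (jn : (j < n.+1)%N))); rewrite !ffunE.
rewrite (eq_integral (fun w => f (Y n w0) (Y n.+1 w))); last first.
  by move=> w /set_mem /= ->.
rewrite [RHS](eq_integral (cst (step (f (Y n w0)) (Y n w0)))); last first.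
  by move=> w /set_mem /= ->.
rewrite integral_cst// (@ge0_integral_cell x n (Y ^~ w0))//.
by rewrite muleC.
Qed.


(** First-step decomposition: [Y_first] restarts the chain from the state occupied at time 1. *)
Lemma step_hit x y n :
  step (fun z => P z [set w | Y n w = x]) y = P y [set w | Y n.+1 w = x].
Proof.
rewrite /step (ge0_integral_fibers (P y) (mY 1))//.
rewrite -[RHS]mul1e -(integral_cst (P y) (mY n.+1 x)).
rewrite (ge0_integral_fibers (P y) (mY 1))//.
apply: eq_eseriesr => k _; rewrite setTI.
have [[z zk]|nz] := pselect (exists z : S, pickle z = k); last first.
  rewrite [X in integral _ X]( _ : _ = set0); last first.
    by apply/seteqP; split => w //= ?; apply: nz; exists (Y 1%N w).
  rewrite [X in _ = integral _ X _]( _ : _ = set0); last first.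
    by apply/seteqP; split => w //= [_ ?]; apply: nz; exists (Y 1%N w).
  by rewrite !integral_set0.
have pk w' : pickle w' = k -> w' = z :> S.
  by rewrite -zk => /(pcan_inj (@pickleK _)).
rewrite [X in integral _ X](_ : _ = [set w | Y 1%N w = z]); last first.
  by apply/seteqP; split => w /=; [move/pk|move=> ->].
rewrite [X in _ = integral _ X _]
    (_ : _ = [set w | Y 1%N w = z /\ Y n.+1 w = x]); last first.
  by apply/seteqP; split => w /= => [[-> /pk]|[-> ->]].
rewrite (eq_integral (cst (P z [set w | Y n w = x]))); last first.
  by move=> w /set_mem /= ->.
rewrite !integral_cst//.
  by rewrite mul1e [RHS](Y_first y n z x) muleC.
exact: (measurableI [set w | Y 1%N w = z] [set w | Y n.+1 w = x]).
exact: (mfY 1 (fun z => P z [set w | Y n w = x])).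
Qed.

(** * Taboo probabilities and expected return times *)

Section Taboo.
Variable x : S.

(* The probability, starting from y, that Y_0, ..., Y_n all differ from x. *)
Fixpoint avoid (n : nat) (y : S) : \bar R :=
  if y == x then 0 else if n is m.+1 then step (avoid m) y else 1.

Lemma avoidS n y :
  avoid n.+1 y = if y == x then 0 else step (avoid n) y.
Proof. by []. Qed.

Lemma avoid_ge0 n y : 0 <= avoid n y.
Proof.
by elim: n y => [|n IH] y /=; case: ifP => // _; exact: step_ge0.
Qed.

Lemma avoid_target n : avoid n x = 0.
Proof. by case: n => [|n] /=; rewrite eqxx. Qed.

Lemma avoid_le1 n y : avoid n y <= 1.
Proof.
elim: n y => [|n IH] y /=; case: ifP => // _.
by rewrite -[leRHS](step_cst 1 y); apply: le_step => // z; exact: avoid_ge0.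
Qed.

Lemma avoid_decr n y : avoid n.+1 y <= avoid n y.
Proof.
elim: n y => [|n IH] y.
  rewrite /=; case: ifP => // _; rewrite -[leRHS](step_cst 1 y).
  by apply: le_step => z; [exact: (avoid_ge0 0)|exact: (avoid_le1 0)].
rewrite avoidS [leRHS]avoidS; case: ifP => // _.
by apply: le_step => // z; exact: avoid_ge0.
Qed.

Lemma avoid_decrW m n y : (m <= n)%N -> avoid n y <= avoid m y.
Proof.
elim: n => [|n IH]; first by rewrite leqn0 => /eqP->.
rewrite leq_eqVlt => /predU1P[->//|/IH]; apply: le_trans; exact: avoid_decr.
Qed.

(** Avoiding [x] up to time [n] and sitting at [x] at time [n] exclude each other. Since [avoid] is
    given by a recursion and not as the measure of an event, the bound is carried along by
    first-step induction. *)
Lemma avoid_hit n y : avoid n y + P y [set w | Y n w = x] <= 1.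
Proof.
have [->|yx] := eqVneq y x; first by rewrite avoid_target add0e probability_le1.
elim: n y yx => [|n IH] y yx.
  rewrite /= (negbTE yx) (_ : P y _ = 0) ?adde0//.
  apply/(measure_negligible (mY 0 x)).
  apply: negligibleS (Y0 y) => w /= -> xy; rewrite xy eqxx in yx *.
  by [].
rewrite /= (negbTE yx) -step_hit -stepD//; last exact: avoid_ge0.
rewrite -[leRHS](step_cst 1 y); apply: le_step => z.
  by rewrite adde_ge0// avoid_ge0.
have [->|/IH//] := eqVneq z x; by rewrite avoid_target add0e probability_le1.
Qed.

(** Applying [step] raises each index by one, and the added 1 supplies the missing term
    [avoid 0 y]. *)
Lemma step_avoid_sum L y : y != x ->
  step (fun z => \sum_(l < L) avoid l z) y + 1
  = \sum_(l < L) avoid l y + avoid L y.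
Proof.
move=> yx; rewrite /step ge0_integral_sum//; last by move=> *; exact: avoid_ge0.
transitivity (\sum_(l < L.+1) avoid l y); last by rewrite big_ord_recr.
rewrite big_ord_recl /= (negbTE yx) addeC; congr (_ + _).
Qed.

(** Each state of [F] hits [x] at some time with positive probability. As [avoid] decreases in [n],
    the largest of these times and the least of these probabilities serve the whole list. *)
Lemma avoid_uniform (F : seq S) :
  (forall y, exists n, 0 < P y [set w | Y n w = x]) ->
  exists L (k : R), (0 < k)%R /\ forall y, y \in F -> avoid L y + k%:E <= 1.
Proof.
move=> irr; elim: F => [|y F [L [k [k0 IH]]]]; first by exists 0%N, 1%R.
have [n ny] := irr y.
have Pf : P y [set w | Y n w = x] \is a fin_num by rewrite fin_num_measure.
exists (maxn L n), (Num.min k (fine (P y [set w | Y n w = x]))).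
split; first by rewrite lt_min k0 -lte_fin fineK.
move=> z; rewrite inE => /predU1P[->|zF].
  apply: le_trans (avoid_hit n y); apply: leeD.
    by apply: avoid_decrW; exact: leq_maxr.
  by rewrite -[leRHS]fineK// lee_fin ge_min lexx orbT.
apply: le_trans (IH _ zF); apply: leeD.
  by apply: avoid_decrW; exact: leq_maxl.
by rewrite lee_fin ge_min lexx.
Qed.

(* Off x the function [sum_(l < L) avoid l] decreases by [1 - avoid L y] in mean,
   which is bounded below on the finite set F for L large; a multiple of it
   therefore absorbs the excess b of the drift of V on F. *)
Lemma lyapunov_avoiding (V : S -> R) (b : R) (F : seq S) :
  (forall y, exists n, 0 < P y [set w | Y n w = x]) ->
  (forall y, 0 <= V y)%R -> (0 <= b)%R ->
  (forall y, step (fun z => (V z)%:E) y + 1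
             <= (V y + if y \in F then b else 0)%:E) ->
  exists U : S -> R,
    [/\ (forall y, 0 <= U y)%R,
        (forall y, y != x ->
           step (fun z => if z == x then 0 else (U z)%:E) y + 1 <= (U y)%:E)
      & step (fun z => if z == x then 0 else (U z)%:E) x \is a fin_num].
Proof.
move=> irr V0 b0 drift; have [L [k [k0 avk]]] := avoid_uniform F irr.
have avf n y : avoid n y \is a fin_num.
  by rewrite ge0_fin_numE ?avoid_ge0// (le_lt_trans (avoid_le1 n y))// ltry.
pose W y := \sum_(l < L) avoid l y.
have W0 y : 0 <= W y by apply: sume_ge0 => l _; exact: avoid_ge0.
have WL y : W y <= L%:R%:E.
  rewrite -[leRHS]mule1 (_ : L%:R%:E * 1 = \sum_(l < L) 1%E :> \bar R).
    by apply: lee_sum => l _; exact: avoid_le1.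
  by rewrite mule1 sumEFin sumr_const card_ord.
have Wf y : W y \is a fin_num.
  by rewrite ge0_fin_numE// (le_lt_trans (WL y))// ltry.
have sW0 y : 0 <= step W y by exact: step_ge0.
have sWf y : step W y \is a fin_num.
  rewrite ge0_fin_numE// (@le_lt_trans _ _ L%:R%:E) ?ltry//.
  by rewrite -[leRHS](step_cst _ y); exact: le_step.
have sV0 y : 0 <= step (fun z => (V z)%:E) y.
  by apply: step_ge0 => z; rewrite lee_fin.
have sVf y : step (fun z => (V z)%:E) y \is a fin_num.
  rewrite ge0_fin_numE// (@le_lt_trans _ _ (step (fun z => (V z)%:E) y + 1))//.
    by rewrite leeDl.
  by apply: le_lt_trans (drift y) _; rewrite ltry.
(* With [c * k = b], the gain [c * (1 - avoid L y)] is at least [b] on [F]; elsewhere it is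
   nonnegative, which suffices. *)
pose c := (b / k)%R; have c0 : (0 <= c)%R by rewrite divr_ge0// ltW.
pose U y := (V y + c * fine (W y))%R.
have UE y : (U y)%:E = (V y)%:E + c%:E * W y.
  by rewrite /U EFinD EFinM fineK.
have U0 y : (0 <= U y)%R by rewrite addr_ge0// mulr_ge0// fine_ge0.
have sU y : step (fun z => if z == x then 0 else (U z)%:E) y
    <= step (fun z => (V z)%:E) y + c%:E * step W y.
  rewrite -stepZ// -stepD//; last first.
    by move=> z; rewrite mule_ge0.
  apply: le_step => z; first by case: ifP; rewrite // lee_fin.
  by rewrite -UE; case: ifP; rewrite // lee_fin.
have sU0 y : 0 <= step (fun z => if z == x then 0 else (U z)%:E) y.
  by apply: step_ge0 => z; case: ifP; rewrite // lee_fin.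
exists U; split=> // [y yx|]; last first.
  rewrite ge0_fin_numE//; apply: le_lt_trans (sU x) _.
  by rewrite -(fineK (sVf x)) -(fineK (sWf x)) ltry.
apply: le_trans (leeD2r 1 (sU y)) _.
have := drift y; have := avk y; have := avoid_le1 L y.
have := step_avoid_sum L y yx; rewrite -/(W y) -/W UE.
rewrite -(fineK (sVf y)) -(fineK (sWf y)) -(fineK (Wf y)) -(fineK (avf L y)).
move: (fine (step (fun z => (V z)%:E) y)) (fine (step W y)) (fine (W y))
  (fine (avoid L y)) => sv sw w a.
rewrite -!EFinM -!EFinD !lee_fin => -[swE] a1 ak dr.
have {}swE : sw = (w + a - 1)%R by rewrite -swE addrK.
rewrite swE; case: ifP ak dr => [_ /(_ isT) ak|_ _] dr.
  have : (c * (a + k) <= c * 1)%R by apply: ler_wpM2l.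
  have : (c * k = b)%R by rewrite /c divfK// gt_eqF.
  by lra.
have : (c * a <= c * 1)%R by apply: ler_wpM2l.
by lra.
Qed.

(** As in [return_time], a return presupposes an exit: on this event the chain is either still
    waiting at [x], never having left, or away on its first excursion. *)
Definition not_returned (n : nat) : set T :=
  [set w | forall i j, (i <= j)%N -> (j <= n)%N -> Y i w <> x -> Y j w <> x].

Lemma not_returned_history n w w' :
  (forall j, (j <= n)%N -> Y j w = Y j w') ->
  not_returned n w -> not_returned n w'.
Proof.
move=> ww' nr i j ij jn.
by rewrite -!ww'//; [exact: nr|exact: leq_trans ij jn].
Qed.

Lemma not_returnedS n w : not_returned n.+1 w ->
  not_returned n w /\ (Y n w <> x -> Y n.+1 w <> x).
Proof.
move=> nr; split=> [i j ij jn|]; first by apply: nr => //; exact: leqW.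
exact: nr.
Qed.

Lemma measurable_not_returned n : measurable (not_returned n).
Proof.
rewrite (_ : not_returned n = \bigcap_(i in [set: nat]) \bigcap_(j in [set: nat])
   [set w | (i <= j)%N -> (j <= n)%N -> Y i w <> x -> Y j w <> x]); last first.
  by apply/seteqP; split => w /= nr i; [move=> _ j _; exact: nr|
    move=> j; exact: nr].
apply: bigcap_measurable => // i _; apply: bigcap_measurable => // j _.
apply: (measurable_preimage_countable (Z := fun w => (Y i w, Y j w))
  _ [set p | (i <= j)%N -> (j <= n)%N -> p.1 <> x -> p.2 <> x]) => -[y z].
rewrite (_ : [set _ | _] = [set w | Y i w = y] `&` [set w | Y j w = z]).
  exact: measurableI.
by apply/seteqP; split => w /= [-> ->].
Qed.

(** If the chain stayed at [x] almost surely in one step, it would be at [x] at every time and could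
    not reach [x']. *)
Lemma stay_lt1 (x' : S) : x' != x -> (exists n, 0 < P x [set w | Y n w = x']) ->
  P x [set w | Y 1%N w = x] < 1.
Proof.
move=> x'x [n leave]; rewrite ltNge; apply/negP => stay.
suff : P x [set w | Y n w = x'] <= 0 by rewrite leNgt leave.
have xx m : P x [set w | Y m w = x] = 1.
  apply/eqP; rewrite eq_le probability_le1//=; elim: m => [|m IH].
    rewrite -(@probability_setT _ _ _ (P x)).
    by apply: ae_le_measure => //; apply: filterS (Y0 x) => w.
  apply: (@le_trans _ _ (P x [set w | Y 1%N w = x /\ Y m.+1 w = x])).
    by rewrite Y_first -[leLHS]mule1; exact: lee_pmul.
  apply: le_measure; rewrite ?inE//; last by move=> w [].
  exact: (measurableI [set w | Y 1%N w = x] [set w | Y m.+1 w = x]).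
rewrite (_ : 0 = P x (~` [set w | Y n w = x])).
  apply: le_measure; rewrite ?inE//; first exact: measurableC.
  by move=> w /= ->; apply/eqP.
by rewrite probability_setC// xx subee.
Qed.

(** A potential bounding the mean remaining time to return is integrated over [not_returned n].
    These integrals drop by at least the probability of [not_returned n] at each step, so the
    probabilities sum to at most the initial value [a]. *)
Lemma foster (x' : S) (V : S -> R) (b : R) (F : seq S) :
  x' != x -> (exists n, 0 < P x [set w | Y n w = x']) ->
  (forall y, exists n, 0 < P y [set w | Y n w = x]) ->
  (forall y, 0 <= V y)%R -> (0 <= b)%R ->
  (forall y, step (fun z => (V z)%:E) y + 1
             <= (V y + if y \in F then b else 0)%:E) ->
  \sum_(n <oo) P x (not_returned n) < +oo.
Proof.
move=> x'x leave irr V0 b0 drift.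
have [U [U0 sU sUf]] := lyapunov_avoiding V b F irr V0 b0 drift.
pose Ux y := if y == x then 0 else (U y)%:E.
have Ux0 y : 0 <= Ux y by rewrite /Ux; case: ifP => // _; rewrite lee_fin.
have r1 := stay_lt1 _ x'x leave; pose r := fine (P x [set w | Y 1%N w = x]).
have rE : P x [set w | Y 1%N w = x] = r%:E by rewrite fineK// fin_num_measure.
rewrite rE lte_fin in r1.
have r0 : (0 <= r)%R by rewrite -lee_fin -rE.
(* a solves a = 1 + r * a + step Ux x: the chain may linger at x before leaving. *)
pose a := ((1 + fine (step Ux x)) / (1 - r))%R.
have a0 : (0 <= a)%R.
  by rewrite divr_ge0 ?subr_ge0 ?addr_ge0 ?fine_ge0 ?(ltW r1)//; exact: step_ge0.
pose Ua y := if y == x then a%:E else (U y)%:E.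
have Ua0 y : 0 <= Ua y by rewrite /Ua; case: ifP => // _; rewrite lee_fin.
have sUa : step Ua x + 1 <= a%:E.
  have -> : step Ua x = step (fun z => a%:E * (\1_[set x] z)%:E + Ux z) x.
    congr (step _ x); apply/funext => z; rewrite /Ua /Ux indicE.
    have [->|zx] := eqVneq z x; first by rewrite mem_set// mule1 adde0.
    by rewrite memNset ?mule0 ?add0e//; apply/eqP.
  rewrite stepD//; last by move=> z; rewrite mule_ge0// lee_fin.
  rewrite stepZ//.
  have -> : step (fun z => (\1_[set x] z)%:E) x = r%:E.
    transitivity (\int[P x]_w (\1_[set w | Y 1%N w = x] w)%:E).
      by apply: eq_integral => w _; rewrite !indicE.
    by rewrite integral_indic// setIT.
  rewrite -(fineK sUf) -EFinM -!EFinD lee_fin.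
  have : (a * (1 - r) = 1 + fine (step Ux x))%R.
    by rewrite divfK// gt_eqF// subr_gt0.
  rewrite -/Ux; lra.
(* The potential after a move from [y] to [z]. Landing on [x] costs [a] if the chain was still
   waiting there, and nothing if it comes back from an excursion. *)
pose G y z := if y == x then Ua z else Ux z.
have G0 y z : 0 <= G y z by rewrite /G; case: ifP.
have sG y : step (G y) y + 1 <= Ua y.
  have [->|yx] := eqVneq y x; first by rewrite /G /Ua eqxx.
  by rewrite /G /Ua (negbTE yx); exact: sU.
pose u n := \int[P x]_(w in not_returned n) Ua (Y n w).
have u_ge0 n : 0 <= u n by exact: integral_ge0.
have uS n : u n.+1 + P x (not_returned n) <= u n.
  have mn := measurable_not_returned n.
  apply: (@le_trans _ _ (\int[P x]_(w in not_returned n)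
    step (G (Y n w)) (Y n w) + P x (not_returned n))).
    apply: leeD => //; rewrite -ge0_integral_history//; last first.
      exact: not_returned_history.
    apply: ge0_le_integral_nonmeas => // w /not_returnedS [nr out].
    split=> //; rewrite /G; case: ifPn => // /eqP /out /eqP nx.
    by rewrite /Ua /Ux (negbTE nx).
  rewrite -[X in _ + X]mul1e -(integral_cst (P x) mn) -ge0_integralD//.
  - apply: ge0_le_integral => //.
    + by move=> w _; rewrite adde_ge0// step_ge0.
    + exact: (mfY n (fun y => step (G y) y + 1)).
  - by move=> w _; exact: step_ge0.
  - exact: (mfY n (fun y => step (G y) y)).
have u0 : u 0%N <= a%:E.
  rewrite (_ : a%:E = \int[P x]_(w in setT) cst a%:E w); last first.
    by rewrite integral_cst// [X in _ * X]probability_setT mule1.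
  apply: (@le_trans _ _ (\int[P x]_(w in setT) Ua (Y 0%N w))).
    exact: ge0_le_integral_nonmeas.
  apply: ae_ge0_le_integral => //.
  by apply: filterS (Y0 x) => w Yw _; rewrite Yw /Ua eqxx.
have sumu n : \sum_(0 <= k < n) P x (not_returned k) + u n <= a%:E.
  elim: n => [|n IH]; first by rewrite big_nil add0e.
  rewrite big_nat_recr//= -addeA; apply: le_trans IH.
  by apply: leeD => //; rewrite addeC.
apply: (@le_lt_trans _ _ a%:E); last exact: ltry.
apply: lime_le; first exact: is_cvg_nneseries.
apply: nearW => n; apply: le_trans (sumu n).
by rewrite leeDl.
Qed.


End Taboo.

End MarkovChain.

(** * Queue paths and Poisson clocks *)

Section CumulativeService.
Context {R : realType} (f : R -> R).
Hypothesis f01 : forall u, 0 <= f u /\ f u <= 1.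

Let F t := \int[lebesgue_measure]_(u in `[0, t]) f u.

Let ef_ge0 u : (0 <= (f u)%:E)%E.
Proof. by rewrite lee_fin; have [] := f01 u. Qed.

Let lebesgue_itv0 (t : R) : 0 <= t ->
  lebesgue_measure (`[0, t]%classic : set R) = t%:E.
Proof.
move=> t0; rewrite lebesgue_measure_itv/= lte_fin; case: ltgtP t0 => //.
  by rewrite -EFinB subr0.
by move=> <-.
Qed.

Let integral_le t : 0 <= t ->
  (\int[lebesgue_measure]_(u in `[0%R, t]) (f u)%:E <= t%:E)%E.
Proof.
move=> t0; rewrite -(lebesgue_itv0 t t0) -[leRHS]mul1e -integral_cst//.
apply: ge0_le_integral_nonmeas => // u u0t; split=> //=.
by rewrite lee_fin; have [] := f01 u.
Qed.

Let integral_fin t : 0 <= t ->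
  (\int[lebesgue_measure]_(u in `[0%R, t]) (f u)%:E)%E \is a fin_num.
Proof.
move=> t0; rewrite ge0_fin_numE; last exact: integral_ge0.
by rewrite (le_lt_trans (integral_le t t0))// ltry.
Qed.

(** Comparison of lower integrals is used here and in [le_cumulative], since only the bounds on [f]
    are given and its measurability is unknown. *)
Lemma cumulative_le t : 0 <= t -> F t <= t.
Proof.
by move=> t0; rewrite /F /Rintegral -lee_fin fineK ?integral_fin ?integral_le.
Qed.

Lemma cumulative_ge0 t : 0 <= F t.
Proof. by rewrite /F /Rintegral fine_ge0// integral_ge0. Qed.

Lemma le_cumulative s t : 0 <= s -> s <= t -> F s <= F t.
Proof.
move=> s0 st; have t0 := le_trans s0 st.
rewrite /F /Rintegral -lee_fin !fineK ?integral_fin//.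
apply: ge0_le_integral_nonmeas => // u; rewrite /= !in_itv/= => /andP[-> us].
by split=> //; exact: le_trans us st.
Qed.

Lemma cumulative_cst c t : 0 <= t -> (forall u, 0 <= u -> u <= t -> f u = c) ->
  F t = c * t.
Proof.
move=> t0 fc; rewrite /F /Rintegral (eq_integral (cst c%:E)).
  by rewrite integral_cst// [X in (_ * X)%E](lebesgue_itv0 t t0).
by move=> u; rewrite inE/= in_itv/= => /andP[u0 ut]; rewrite fc.
Qed.

End CumulativeService.

Section Paths.
Context {R : realType} {N : nat} (psi : state N -> 'rV[R]_N).
Hypothesis psi01 : forall x i, 0 <= psi x 0 i /\ psi x 0 i <= 1.
Variables (a s : 'I_N -> R -> nat) (X : R -> state N).
Hypothesis a_counting : forall i, counting_path (a i).
Hypothesis s_counting : forall i, counting_path (s i).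
Hypothesis XE : forall t i, 0 <= t ->
  (X t i)%:Z = (X 0 i)%:Z + (a i t)%:Z
    - (s i (\int[lebesgue_measure]_(u in `[0, t]) psi (X u) 0 i))%:Z.

Let G i t := \int[lebesgue_measure]_(u in `[0, t]) psi (X u) 0 i.

Let G_le i t : 0 <= t -> G i t <= t.
Proof. by move=> t0; apply: cumulative_le. Qed.

Let G_ge0 i t : 0 <= G i t.
Proof. exact: cumulative_ge0. Qed.

Let G_homo i r t : 0 <= r -> r <= t -> G i r <= G i t.
Proof. by move=> r0 rt; exact: le_cumulative. Qed.

Let a_homo i r t : 0 <= r -> r <= t -> (a i r <= a i t)%N.
Proof. by case: (a_counting i) => _ + _; apply. Qed.

Let s_homo i r t : 0 <= r -> r <= t -> (s i r <= s i t)%N.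
Proof. by case: (s_counting i) => _ + _; apply. Qed.

(** Departures are kept on the left to avoid truncated subtraction in [nat]. *)
Lemma queue_balance t i : 0 <= t -> (X t i + s i (G i t) = X 0 i + a i t)%N.
Proof.
move=> t0; apply/eqP; rewrite -eqz_nat !PoszD XE// -/(G i t).
by rewrite subrK.
Qed.

Lemma queue_le t i : 0 <= t -> (X t i <= X 0 i + a i t)%N.
Proof. by move=> t0; rewrite -queue_balance// leq_addr. Qed.

(** Clocks and cumulative services are monotone, so counts that vanish at [t] vanish at all earlier
    times. *)
Lemma queue_frozen t : 0 <= t -> (forall i, a i t = 0%N) ->
  (forall i, s i (G i t) = 0%N) -> forall u, 0 <= u -> u <= t -> X u = X 0.
Proof.
move=> t0 a0 s0 u u0 ut; apply/ffunP => i.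
have := queue_balance u i u0.
have /eqP -> : a i u == 0%N by rewrite -leqn0 -(a0 i) a_homo.
have /eqP -> : s i (G i u) == 0%N by rewrite -leqn0 -(s0 i) s_homo// G_homo.
by rewrite !addn0.
Qed.

(** Service rates at most 1 keep [G i t] below [t], so service clocks silent up to [t] produce no
    departure. *)
Lemma queue_idle t : 0 <= t -> (forall i, a i t = 0%N) ->
  (forall i, s i t = 0%N) -> X t = X 0.
Proof.
move=> t0 a0 s0; apply: (queue_frozen t) => // i.
by apply/eqP; rewrite -leqn0 -(s0 i) s_homo// G_le.
Qed.

(* Before its first transition the process stays at X 0, so the clock of queue i
   reads psi (X 0) i * t at time t unless a departure has occurred. *)
Lemma queue_departure t i : 0 <= t -> (forall j, a j t = 0%N) ->
  (forall j, j != i -> s j t = 0%N) -> s i (psi (X 0) 0 i * t) = 1%N ->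
  (X t i < X 0 i)%N.
Proof.
move=> t0 a0 s0 si; rewrite -[X 0 i]addn0 -(a0 i) -queue_balance// -[ltnLHS]addn0.
rewrite ltn_add2l lt0n; apply/eqP => sG0.
have froz : forall u, 0 <= u -> u <= t -> X u = X 0.
  apply: queue_frozen => // j; have [->//|ji] := eqVneq j i.
  by apply/eqP; rewrite -leqn0 -(s0 j ji) s_homo// G_le.
move: si; rewrite -(cumulative_cst (fun u => psi (X u) 0 i)) -/(G i t) ?sG0//.
by move=> u u0 ut; rewrite froz.
Qed.

End Paths.

(** * Laws of Poisson clocks at fixed times *)

Section Poisson.
Context {d : measure_display} {T : measurableType d} {R : realType}.
Variable P : probability T R.
Local Open Scope ereal_scope.

(** The single increment over [[0, t]]. The two events agree only almost everywhere, because
    [A 0 = 0] is an almost sure property. *)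
Lemma poisson_process_law rate (A : R -> T -> nat) t k : (0 <= t)%R ->
  is_poisson_process P rate A ->
  P [set w | A t w = k] = (poisson_weight (rate * t) k)%:E.
Proof.
move=> t0 [mA cA incr].
pose tt (j : nat) : R := if j is 0 then 0%R else t.
have := incr 1%N tt (fun=> k) (lexx _).
rewrite big_ord1 /tt subr0 => <-; last by case.
apply: ae_eq_measure.
- exact: mA.
- rewrite (_ : [set _ | _] =
      [set w | [set p : nat * nat | p.1 = (p.2 + k)%N] (A t w, A 0%R w)]).
    apply: measurable_preimage_countable => -[m n].
    rewrite (_ : [set _ | _] = [set w | A t w = m] `&` [set w | A 0%R w = n]).
      by apply: measurableI; exact: mA.
    by apply/seteqP; split => w /= [-> ->].
  apply/seteqP; split => w /= => [/(_ 0%N)|H [|//] _]; first exact.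
  exact: H.
- apply: filterS cA => w [A0 _ _]; split => /= [AE [|//] _|/(_ 0%N)].
    by rewrite A0.
  by rewrite A0; exact.
Qed.

Lemma poisson_weight0 (r : R) : poisson_weight r 0 = expR (- r).
Proof. by rewrite /poisson_weight expr0 fact0 divr1 mul1r. Qed.

Lemma poisson_weight1 (r : R) : poisson_weight r 1 = (r * expR (- r))%R.
Proof. by rewrite /poisson_weight expr1 divr1. Qed.

(** The generating function of the Poisson law at 2, that is [expR (- r) * expR (2 * r)]; base 2
    matches the bound on [g] used in [cumulative_weight_growth]. *)
Lemma nneseries_poisson_exp2 (r : R) : (0 <= r)%R ->
  \sum_(k <oo) (2 ^+ k * poisson_weight r k)%:E = (expR r)%:E.
Proof.
move=> r0.
have -> : expR r = (expR (- r) * limn (series (exp_coeff (2 * r))))%R.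
  by rewrite -/(expR (2 * r)) -expRD; congr expR; ring.
have cs := is_cvg_series_exp_coeff (2 * r)%R.
apply/cvg_lim => //.
rewrite (_ : (fun n => _) =
    EFin \o (fun n => expR (- r) * series (exp_coeff (2 * r)) n)%R).
  by apply: (cvg_comp _ _ (cvgM (cvg_cst (expR (- r))) cs)).
apply/funext => n; rewrite /= sumEFin /series /= mulr_sumr; congr EFin.
by apply: eq_bigr => k _; rewrite /poisson_weight /exp_coeff /= exprMn; ring.
Qed.

End Poisson.

(** * Supergradients and growth of the weight *)

Section Analysis.
Context {R : realType}.

(** The constant is the right derivative of [h] at [nu], taken as the supremum of the difference
    quotients to the right. Concavity puts these below every quotient to the left, which settles
    [mu < nu]; a value [h mu = -oo] satisfies the bound trivially. *)
Lemma service_utility_supergradient (h : R -> \bar R) (nu : R) :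
  service_utility h -> 0 < nu ->
  exists2 c, 0 < c & forall mu, 0 <= mu ->
    (h mu <= (fine (h nu) + c * (mu - nu))%:E)%E.
Proof.
move=> [hf hlt _ hc _] nu0.
have hE y : 0 < y -> h y = (fine (h y))%:E by move=> y0; rewrite fineK ?hf.
pose slope z := (fine (h z) - fine (h nu)) / (z - nu).
have slopeE z : nu < z -> slope z * (z - nu) = fine (h z) - fine (h nu).
  by move=> nz; rewrite divfK// subr_eq0 gt_eqF.
have three_slopes mu z : 0 <= mu -> mu < nu -> nu < z ->
    (h mu <= (fine (h nu) + slope z * (mu - nu))%:E)%E.
  move=> mu0 mn nz; have z0 := lt_trans nu0 nz.
  (* The weight for which [nu = t * mu + (1 - t) * z]. *)
  pose t := (z - nu) / (z - mu).
  have zm : 0 < z - mu by rewrite subr_gt0 (lt_trans mn).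
  have t0 : 0 < t by rewrite divr_gt0// subr_gt0.
  have tE : t * (z - mu) = z - nu by rewrite divfK// gt_eqF.
  have t1 : t <= 1 by rewrite ler_pdivrMr// mul1r lerD2l lerN2 ltW.
  have := hc mu z t mu0 (ltW z0) (ltW t0) t1.
  have -> : t * mu + (1 - t) * z = nu by rewrite -[nu]opprK -(subKr z nu) -tE; ring.
  rewrite (hE nu nu0) (hE z z0).
  have : (h mu < +oo)%E by apply: lt_trans (hlt _ _ mu0 mn) _; rewrite (hE nu nu0) ltry.
  case: (h mu) => [m|//|_ _]; last by rewrite leNye.
  move=> _; rewrite -!EFinM -EFinD !lee_fin; move: (slopeE z nz).
  move: (fine (h z)) (fine (h nu)) => hz hn /= sE ineq.
  have sE' : slope z * (z - mu) * t = hz - hn by rewrite -sE -tE; ring.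
  rewrite -(ler_pM2l t0).
  have -> : t * (hn + slope z * (mu - nu)) =
     t * hn + (slope z * (z - nu) * t - slope z * (z - mu) * t) by ring.
  by rewrite sE' sE; lra.
have slope_gt0 z : nu < z -> 0 < slope z.
  move=> nz; rewrite divr_gt0 ?subr_gt0//.
  rewrite -lte_fin -(hE _ nu0) -(hE _ (lt_trans nu0 nz)).
  by apply: hlt => //; exact: ltW.
pose A := [set slope z | z in [set z | nu < z]].
have nu1 : nu < nu + 1 by rewrite ltrDl.
have A_sup : has_sup A.
  split; first by exists (slope (nu + 1)), (nu + 1).
  (* Any point strictly between 0 and [nu] gives a finite left quotient that bounds all right
     quotients. *)
  have half : nu / 2 < nu by rewrite ltr_pdivrMr// ltr_pMr// ltr1n.
  have half0 : 0 < nu / 2 by rewrite divr_gt0.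
  exists ((fine (h nu) - fine (h (nu / 2))) / (nu / 2)) => _ [z nz <-].
  have := three_slopes _ z (ltW half0) half nz; rewrite (hE _ half0) lee_fin => H.
  by rewrite ler_pdivlMr//; lra.
exists (sup A).
  apply: lt_le_trans (slope_gt0 _ nu1) _.
  by apply: sup_upper_bound => //; exists (nu + 1).
move=> mu mu0; case: (ltgtP mu nu) => [mn|nm|->]; last first.
- by rewrite subrr mulr0 addr0 -hE.
- have m0 := lt_trans nu0 nm; rewrite (hE _ m0) lee_fin -lerBlDl -slopeE//.
  rewrite ler_wpM2r ?subr_ge0 ?(ltW nm)//.
  by apply: sup_upper_bound => //; exists mu.
have hmu z : nu < z -> (h mu <= (fine (h nu) + slope z * (mu - nu))%:E)%E.
  exact: three_slopes.
have : (h mu < +oo)%E by apply: lt_trans (hlt _ _ mu0 mn) _; rewrite (hE nu nu0) ltry.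
case: (h mu) hmu => [m|//|_ _]; last by rewrite leNye.
move=> hmu _; rewrite lee_fin; have nm0 : 0 < nu - mu by rewrite subr_gt0.
suff : sup A <= (fine (h nu) - m) / (nu - mu) by rewrite ler_pdivlMr//; lra.
apply: sup_le_ub; first by case: A_sup.
move=> _ [z nz <-]; rewrite ler_pdivlMr//.
by have := hmu z nz; rewrite lee_fin; lra.
Qed.

(** At [t = 0] the inequality reads [lambda i < nu i]; it persists nearby by continuity, uniformly
    over the finitely many queues. *)
Lemma small_time {N : nat} (lambda nu : 'I_N -> R) (L : R) :
  (forall i, lambda i < nu i) ->
  exists t, [/\ 0 < t, t < 1 & forall i,
    lambda i * expR (lambda i * t) < expR (- (L * t)) * (1 - t) * nu i].
Proof.
move=> ln.
have near_i i : \forall t \near 0^'+,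
    lambda i * expR (lambda i * t) < expR (- (L * t)) * (1 - t) * nu i.
  pose f t := expR (- (L * t)) * (1 - t) * nu i - lambda i * expR (lambda i * t).
  have cf : {for 0, continuous f}.
    have idc : (id : R -> R) @ (0 : R) --> (0 : R) by exact: cvg_id.
    apply: cvgB.
      apply: cvgM; last exact: cvg_cst.
      apply: cvgM; last by apply: cvgB => //; exact: cvg_cst.
      apply: (@continuous_comp _ _ _ (fun t => - (L * t)) expR); last exact: continuous_expR.
      by apply: cvgN; apply: cvgM => //; exact: cvg_cst.
    apply: cvgM; first exact: cvg_cst.
    apply: (@continuous_comp _ _ _ (fun t => lambda i * t) expR); last exact: continuous_expR.
    by apply: cvgM => //; exact: cvg_cst.
  have f0 : 0 < f 0.
    by rewrite /f !mulr0 oppr0 expR0 addr0 !mul1r mulr1 subr_gt0.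
  have : \forall t \near 0^'+, 0 < f t.
    by apply: cvg_within; exact: (cvgr_gt _ cf).
  by apply: filterS => t; rewrite subr_gt0.
have : \forall t \near 0^'+, [/\ 0 < t, t < 1 & forall i,
    lambda i * expR (lambda i * t) < expR (- (L * t)) * (1 - t) * nu i].
  near=> t; split; near: t.
  - exact: nbhs_right_gt.
  - exact: nbhs_right_lt.
  - exact: filter_forall.
by move=> /filter_ex.
Unshelve. all: by end_near. Qed.

(** From some [n0] on, the increments of [g] are at most [eta * g n]; before [n0], monotonicity
    gives [g n.+1 <= g n0], whence the constant. *)
Lemma queue_weight_growth (g : nat -> R) (eta : R) : queue_weight g -> 0 < eta ->
  exists2 K, 0 <= K & forall n, g n.+1 <= (1 + eta) * g n + K.
Proof.
move=> [g0 gS glim] eta0.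
have g_homo m n : (m <= n)%N -> g m <= g n.
  by apply: (homo_leq (r := fun a b : R => a <= b)) => // [a b c|k];
    [exact: le_trans|exact: ltW].
have /cvgryPge/(_ eta^-1) [n0 _ big] := glim.
exists (g n0) => // n; have [n0n|nn0] := leqP n0 n; last first.
  by rewrite (le_trans (g_homo _ _ nn0))// lerDr mulr_ge0// addr_ge0// ltW.
have := big n n0n; rewrite /= ler_pdivlMr ?subr_gt0// mulrC ler_pdivrMr//.
by have := g0 n0; lra.
Qed.

End Analysis.

(** * One-step drift of a single queue *)

Section CumulativeWeight.
Context {R : realType} (g : nat -> R).
Hypothesis g0 : forall n, 0 <= g n.

Definition cumulative_weight (n : nat) : R := \sum_(k < n) g k.

Lemma cumulative_weightS n :
  cumulative_weight n.+1 = cumulative_weight n + g n.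
Proof. by rewrite /cumulative_weight big_ord_recr. Qed.

Lemma cumulative_weight_ge0 n : 0 <= cumulative_weight n.
Proof. by rewrite sumr_ge0. Qed.

Lemma le_cumulative_weight m n :
  (m <= n)%N -> cumulative_weight m <= cumulative_weight n.
Proof.
apply: (homo_leq (r := fun a b : R => a <= b)) => // [a b c|k].
  exact: le_trans.
by rewrite cumulative_weightS lerDl.
Qed.

(** The quantity [g n + M] at most doubles when [n] grows by one, so the increments are dominated by
    a geometric series with sum [(g n + M) * (2 ^+ k - 1)]. *)
Lemma cumulative_weight_growth M n k : 0 <= M ->
  (forall n, g n.+1 <= 2 * g n + M) ->
  cumulative_weight (n + k) + (g n + M)
  <= cumulative_weight n + (g n + M) * 2 ^+ k.
Proof.
move=> M0 gM; have gk j : g (n + j) + M <= (g n + M) * 2 ^+ j.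
  elim: j => [|j IH]; first by rewrite addn0 expr0 mulr1.
  by rewrite addnS exprS; have := gM (n + j)%N; nra.
elim: k => [|k IH]; first by rewrite addn0 expr0 mulr1.
by rewrite addnS cumulative_weightS exprS; have := gk k; lra.
Qed.

End CumulativeWeight.

Section Network.
Context {R : realType} {d : measure_display} {T : measurableType d} {N : nat}.
Variables (lambda : 'I_N -> R) (psi : state N -> 'rV[R]_N).
Variables (P : state N -> probability T R) (Arr Srv : 'I_N -> R -> T -> nat).
Variable X : R -> T -> state N.
Hypothesis lambda_ge0 : forall i, 0 <= lambda i.
Hypothesis psi01 : forall x i, 0 <= psi x 0 i /\ psi x 0 i <= 1.
Hypothesis mX : forall t y, 0 <= t -> measurable [set w | X t w = y].
Hypothesis X0 : forall x, {ae P x, forall w, X 0 w = x}.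
Hypothesis X_network : queueing_network lambda psi P Arr Srv X.

Definition network_path (x : state N) (w : T) : Prop :=
  [/\ X 0 w = x, (forall i, counting_path (Arr i ^~ w)),
      (forall i, counting_path (Srv i ^~ w))
    & forall t i, 0 <= t -> (X t w i)%:Z = (X 0 w i)%:Z + (Arr i t w)%:Z
            - (Srv i (\int[lebesgue_measure]_(u in `[0, t]) psi (X u w) 0 i)
                     w)%:Z].

Lemma ae_network_path x : {ae P x, forall w, network_path x w}.
Proof.
have [Ap Sp _ XE] := X_network x.
have ca : {ae P x, forall w, forall i, counting_path (Arr i ^~ w)}.
  by apply: filter_forall => i; have [] := Ap i.
have cs : {ae P x, forall w, forall i, counting_path (Srv i ^~ w)}.
  by apply: filter_forall => i; have [] := Sp i.
by apply: filterS (filterI (filterI (X0 x) ca) (filterI cs XE)) => w [[? ?] [? ?]].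
Qed.

Let mA i t k : 0 <= t -> measurable [set w | Arr i t w = k].
Proof. by have [Ap _ _ _] := X_network [ffun=> 0%N]; have [m _ _] := Ap i; exact: m. Qed.

Let mS i t k : 0 <= t -> measurable [set w | Srv i t w = k].
Proof. by have [_ Sp _ _] := X_network [ffun=> 0%N]; have [m _ _] := Sp i; exact: m. Qed.

(** Every clock has its own reading time, since in [departure] one service clock is read earlier
    than the others may be. *)
Definition clocks (ta ts : 'I_N -> R) (ka ks : 'I_N -> nat) : set T :=
  [set w | (forall i, Arr i (ta i) w = ka i) /\
           (forall i, Srv i (ts i) w = ks i)].

Lemma measurable_clocks ta ts ka ks :
  (forall i, 0 <= ta i) -> (forall i, 0 <= ts i) ->
  measurable (clocks ta ts ka ks).
Proof.
move=> ta0 ts0.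
rewrite (_ : clocks _ _ _ _ =
  \bigcap_(i in [set: 'I_N]) [set w | Arr i (ta i) w = ka i] `&`
  \bigcap_(i in [set: 'I_N]) [set w | Srv i (ts i) w = ks i]).
  apply: measurableI; apply: fin_bigcap_measurable => // i _.
    exact: mA.
  exact: mS.
apply/seteqP; split => w /= [Aw Sw].
  by split=> i _; [exact: Aw|exact: Sw].
by split=> i; [exact: (Aw i)|exact: (Sw i)].
Qed.

Lemma clocks_law x ta ts ka ks :
  (forall i, 0 <= ta i) -> (forall i, 0 <= ts i) ->
  P x (clocks ta ts ka ks)
  = ((\prod_i poisson_weight (lambda i * ta i) (ka i))
     * (\prod_i poisson_weight (ts i) (ks i)))%:E.
Proof.
move=> ta0 ts0; have [Ap Sp ind _] := X_network x.
pose t (c : 'I_N + 'I_N) := match c with inl i => ta i | inr i => ts i end.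
pose k (c : 'I_N + 'I_N) := match c with inl i => ka i | inr i => ks i end.
have := ind 1%N (fun c _ => t c) (fun c _ => k c).
have t0 c : 0 <= t c by case: c.
move=> /(_ (fun c _ => t0 c)) indE.
rewrite (_ : clocks _ _ _ _ = [set w | forall (i : 'I_N + 'I_N) (j : 'I_1),
   (match i with inl i0 => Arr i0 | inr i0 => Srv i0 end) (t i) w = k i]); last first.
  apply/seteqP; split => w /= => [[Aw Sw] [] i _ //|H].
  by split=> i; [exact: (H (inl i) ord0)|exact: (H (inr i) ord0)].
rewrite indE big_sumType /= EFinM -!prodEFin; congr (_ * _)%E; apply: eq_bigr => i _.
  rewrite (_ : [set _ | _] = [set w | Arr i (ta i) w = ka i]).
    exact: poisson_process_law.
  by apply/seteqP; split => w /= => [/(_ ord0)|].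
rewrite (_ : [set _ | _] = [set w | Srv i (ts i) w = ks i]).
  by rewrite (@poisson_process_law _ _ _ _ 1)// mul1r.
by apply/seteqP; split => w /= => [/(_ ord0)|].
Qed.

(** With positive probability no clock rings before [t]. *)
Lemma idle_gt0 x t : 0 <= t -> (0 < P x [set w | X t w = x])%E.
Proof.
move=> t0; pose E := clocks (fun=> t) (fun=> t) (fun=> 0%N) (fun=> 0%N).
apply: (@lt_le_trans _ _ (P x E)).
  rewrite clocks_law// lte_fin mulr_gt0//; apply: prodr_gt0 => i _;
    by rewrite poisson_weight0 expR_gt0.
apply: ae_le_measure; [exact: measurable_clocks|exact: mX|].
apply: filterS (ae_network_path x) => w [xE ca cs XE] [Aw Sw] /=.
by rewrite -xE (queue_idle psi psi01 (fun i t => Arr i t w) (fun i t => Srv i t w)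
  (fun t => X t w)).
Qed.

(** Service clock [i] is read at [psi x 0 i * t], the service it would have accumulated had the
    state stayed at [x]. This reading time is deterministic, so [clocks_law] gives the
    probability. *)
Definition departure (x : state N) (t : R) (i : 'I_N) : set T :=
  clocks (fun=> t) (fun j => if j == i then psi x 0 i * t else t)
         (fun=> 0%N) (fun j => (j == i) : nat).

Lemma measurable_departure x t i : 0 <= t -> measurable (departure x t i).
Proof.
move=> t0; apply: measurable_clocks => // j; case: ifP => // _.
by rewrite mulr_ge0//; have [] := psi01 x i.
Qed.

(** In the product given by [clocks_law], clock [i] contributes
    [psi x 0 i * t * expR (- (psi x 0 i * t))], and [psi x 0 i <= 1] allows the exponential to be
    replaced by [expR (- t)]. *)
Lemma departure_ge x t i : 0 <= t ->
  ((psi x 0 i * t * expR (- ((\sum_j lambda j + N%:R) * t)))%:E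
   <= P x (departure x t i))%E.
Proof.
move=> t0; have [p0 p1] := psi01 x i.
rewrite clocks_law//; last by move=> j; case: ifP => // _; rewrite mulr_ge0.
rewrite lee_fin; under eq_bigr do rewrite poisson_weight0.
rewrite -expR_sum sumrN -mulr_suml mulrDl opprD expRD mulrCA.
apply: ler_wpM2l; first exact: expR_ge0.
have -> : expR (- (N%:R * t)) = \prod_(j < N) expR (- t) :> R.
  by rewrite prodr_const card_ord -expRM_natl mulrN.
rewrite (bigD1 i)//= [leRHS](bigD1 i)//= eqxx poisson_weight1 mulrA.
apply: ler_pM.
- by rewrite !mulr_ge0 ?expR_ge0.
- by apply: prodr_ge0 => j _; exact: expR_ge0.
- apply: ler_wpM2l; first by rewrite mulr_ge0.
  by rewrite ler_expR lerN2 ler_piMl.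
apply: ler_prod => j /negbTE ji.
by rewrite ji poisson_weight0 expR_ge0 lexx.
Qed.

Section Drift.
Context (g : nat -> R) (M : R).
Hypothesis g0 : forall n, 0 <= g n.
Hypothesis M0 : 0 <= M.
Hypothesis gM : forall n, g n.+1 <= 2 * g n + M.

Let G := cumulative_weight g.

Let mXi t i (f : nat -> \bar R) : 0 <= t ->
  measurable_fun setT (fun w => f (X t w i)).
Proof.
move=> t0.
by apply: (@measurable_fun_countable _ _ R _ (X t) _ (fun y => f (y i))) => y; exact: mX.
Qed.

Let mAi t i (f : nat -> \bar R) : 0 <= t ->
  measurable_fun setT (fun w => f (Arr i t w)).
Proof.
move=> t0.
by apply: (@measurable_fun_countable _ _ R _ (Arr i t) _ f) => k; exact: mA.
Qed.

Lemma integral_exp2_arrivals x t i : 0 <= t ->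
  (\int[P x]_w (2 ^+ (Arr i t w))%:E)%E = (expR (lambda i * t))%:E.
Proof.
move=> t0; have [Ap _ _ _] := X_network x.
rewrite (ge0_integral_fibers (P x) (fun k => mA i t k t0))//; last first.
  exact: (mAi t i (fun k => (2 ^+ k)%:E)).
rewrite -nneseries_poisson_exp2 ?mulr_ge0//; apply: eq_eseriesr => k _.
rewrite setTI (eq_integral (cst (2 ^+ k)%:E)); last by move=> w /set_mem /= <-.
rewrite integral_cst; last exact: mA.
by rewrite [X in (_ * X)%E](poisson_process_law _ _ _ _ _ t0 (Ap i)) -EFinM.
Qed.

(** A bound valid on almost every path is integrated: on [departure] there is no arrival and the
    queue has shrunk; elsewhere it grows by at most the arrivals, whose effect [2 ^+ Arr i t w]
    dominates. *)
Lemma queue_drift x t i : 0 <= t ->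
  (\int[P x]_w (G (X t w i))%:E
   + (g (x i).-1 * (psi x 0 i * t * expR (- ((\sum_j lambda j + N%:R) * t))))%:E
   <= (G (x i) + (g (x i) + M) * (expR (lambda i * t) - 1))%:E)%E.
Proof.
move=> t0; have mB := measurable_departure x t i t0.
have gx0 : 0 <= g (x i) + M by rewrite addr_ge0.
(* The term [g (x i) + M] is added here rather than subtracted from [f'], so that all summands are
   nonnegative and both integrals split. *)
pose f w := ((G (X t w i))%:E + (g (x i).-1)%:E * (\1_(departure x t i) w)%:E
             + (g (x i) + M)%:E)%E.
pose f' w := ((G (x i))%:E + (g (x i) + M)%:E * (2 ^+ (Arr i t w))%:E)%E.
have mG : measurable_fun setT (fun w => (G (X t w i))%:E).
  exact: (mXi t i (fun k => (G k)%:E)).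
have mI : measurable_fun setT
    (fun w => (g (x i).-1)%:E * (\1_(departure x t i) w)%:E : \bar R)%E.
  by apply: measurable_funeM; apply/measurable_EFinP; exact: measurable_indic.
have m2 : measurable_fun setT
    (fun w => ((g (x i) + M)%:E * (2 ^+ (Arr i t w))%:E : \bar R)%E).
  exact: (mAi t i (fun k => ((g (x i) + M)%:E * (2 ^+ k)%:E)%E)).
have G0 n : 0 <= G n by exact: cumulative_weight_ge0.
have fle : (\int[P x]_w f w <= \int[P x]_w f' w)%E.
  apply: ae_ge0_le_integral => //.
  - by move=> w _; rewrite !adde_ge0 ?mule_ge0 ?lee_fin.
  - apply: emeasurable_funD => //; exact: emeasurable_funD.
  - by move=> w _; rewrite adde_ge0 ?mule_ge0 ?lee_fin ?exprn_ge0.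
  - exact: emeasurable_funD.
  apply: filterS (ae_network_path x) => w [xE ca cs XE] _.
  have growth := cumulative_weight_growth g M (x i) (Arr i t w) M0 gM.
  have Xle : (X t w i <= x i + Arr i t w)%N.
    rewrite -xE; exact: (queue_le psi (fun i t => Arr i t w)
      (fun i t => Srv i t w) (fun t => X t w)).
  rewrite /f /f' indicE -!EFinM -!EFinD lee_fin; apply: le_trans growth.
  rewrite lerD2r; have [|_] := boolP (w \in _); last first.
    by rewrite mulr0 addr0; exact: le_cumulative_weight.
  rewrite inE => -[Aw Sw]; rewrite Aw addn0 mulr1.
  have : (X t w i < x i)%N.
    rewrite -xE; apply: (queue_departure psi psi01 (fun i t => Arr i t w)
      (fun i t => Srv i t w) (fun t => X t w)) => //.
      by move=> j ji; have := Sw j; rewrite (negbTE ji).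
    by have := Sw i; rewrite eqxx xE.
  (* An empty queue cannot shrink, so the default [0.-1 = 0] never matters on this event. *)
  case: (x i) => // n; rewrite ltnS /= => Xn.
  by rewrite /G cumulative_weightS lerD2r; exact: le_cumulative_weight.
have PT : P x [set: T] = 1%E by exact: probability_setT.
have fE : (\int[P x]_w f w = \int[P x]_w (G (X t w i))%:E
    + (g (x i).-1)%:E * P x (departure x t i) + (g (x i) + M)%:E)%E.
  rewrite /f ge0_integralD//; [|by move=> w _; rewrite adde_ge0 ?mule_ge0 ?lee_fin
    |exact: emeasurable_funD].
  rewrite ge0_integralD//; [|by move=> w _; rewrite lee_fin
    |by move=> w _; rewrite mule_ge0 ?lee_fin].
  rewrite ge0_integralZl_EFin//; last first.
    by apply/measurable_EFinP; exact: measurable_indic.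
  by rewrite integral_indic// setIT integral_cst// [X in (_ + _ * X = _)%E]PT mule1.
have f'E : (\int[P x]_w f' w
    = (G (x i))%:E + (g (x i) + M)%:E * (expR (lambda i * t))%:E)%E.
  rewrite /f' ge0_integralD//; [|by move=> w _; rewrite lee_fin
    |by move=> w _; rewrite mule_ge0 ?lee_fin ?exprn_ge0].
  rewrite ge0_integralZl_EFin//; last first.
    exact: (mAi t i (fun k => (2 ^+ k)%:E)).
  by rewrite integral_exp2_arrivals// integral_cst// [X in (_ * X + _ = _)%E]PT mule1.
rewrite fE f'E in fle; apply: (@le_trans _ _ (\int[P x]_w (G (X t w i))%:E
    + (g (x i).-1)%:E * P x (departure x t i))%E).
  apply: leeD => //; rewrite EFinM; apply: lee_wpmul2l; first by rewrite lee_fin.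
  exact: departure_ge.
rewrite -(leeD2rE _ _ (isT : (g (x i) + M)%:E \is a fin_num)); apply: le_trans fle _.
by rewrite -EFinM -!EFinD lee_fin; lra.
Qed.

End Drift.

End Network.

(** * Drift of the skeleton chain and positive recurrence *)

Section Stability.
Context {R : realType} {d : measure_display} {T : measurableType d} {N : nat}.
Variables (lambda : 'I_N -> R) (C : set 'rV[R]_N) (g : nat -> R).
Variables (h : R -> \bar R) (psi : state N -> 'rV[R]_N).
Variables (P : state N -> probability T R) (Arr Srv : 'I_N -> R -> T -> nat).
Variable X : R -> T -> state N.
Hypothesis lambda_ge0 : forall i, 0 <= lambda i.
Hypothesis h_util : service_utility h.
Hypothesis g_weight : queue_weight g.
Hypothesis g_unbounded : g @ \oo --> +oo.
Hypothesis psi_max : utility_maximising C g h psi.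
Hypothesis X_network : queueing_network lambda psi P Arr Srv X.
Hypothesis X_markov : markov_process P X.
Variable nu : 'rV[R]_N.
Hypothesis C_nu : C nu.
Hypothesis lambda_nu : forall i, lambda i < nu 0 i.

Let g0 n : 0 <= g n. Proof. by have [] := g_weight. Qed.

Let psi01 x i : 0 <= psi x 0 i /\ psi x 0 i <= 1.
Proof. by have [] := psi_max x. Qed.

Let nu_gt0 i : 0 < nu 0 i.
Proof. exact: le_lt_trans (lambda_nu i). Qed.

Let mX t y : 0 <= t -> measurable [set w | X t w = y].
Proof. by have [mX _ _] := X_markov; exact: mX. Qed.

Let X0 x : {ae P x, forall w, X 0 w = x}.
Proof. by have [_ + _] := X_markov; apply. Qed.

(* Concavity linearises the optimality of psi x against nu. *)
Lemma weighted_service_ge (c : 'I_N -> R) (x : state N) :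
  (forall i mu, 0 <= mu ->
     (h mu <= (fine (h (nu 0%R i)) + c i * (mu - nu 0%R i))%:E)%E) ->
  \sum_i g (x i) * c i * nu 0 i <= \sum_i g (x i) * c i * psi x 0 i.
Proof.
move=> hc; have [_ opt _ _] := psi_max x.
have [hf _ _ _ _] := h_util.
have : (\sum_(i < N) (g (x i) * fine (h (nu ord0 i)))%:E <=
        \sum_(i < N) (g (x i) * (fine (h (nu ord0 i))
                       + c i * (psi x ord0 i - nu ord0 i)))%:E)%E.
  apply: (@le_trans _ _ (network_utility g h x (psi x))).
    apply: le_trans (opt _ C_nu); rewrite /network_utility le_eqVlt.
    by apply/orP; left; apply/eqP; apply: eq_bigr => i _; rewrite EFinM fineK ?hf.
  apply: lee_sum => i _; rewrite EFinM; apply: lee_wpmul2l; first by rewrite lee_fin.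
  by apply: hc; have [] := psi01 x i.
rewrite !sumEFin lee_fin => H; rewrite -subr_ge0 -sumrB.
move: H; rewrite -subr_ge0 -sumrB => H; apply: le_trans H _.
by apply: ler_sum => i _; rewrite le_eqVlt; apply/orP; left; apply/eqP; ring.
Qed.

Let G := cumulative_weight g.

(** Both terms of the drift are brought to the form [t] times an affine function of [g (x i)];
    replacing [g (x i).-1] by [(1 - t) * g (x i) - K] costs at most [t * K]. *)
Lemma queue_drift_linear (t M K : R) (x : state N) (i : 'I_N) :
  0 < t -> t < 1 -> 0 <= M -> 0 <= K ->
  (forall n, g n.+1 <= 2 * g n + M) ->
  (forall n, g n.+1 <= (1 + t) * g n + K) ->
  (\int[P x]_w (G (X t w i))%:E
   <= (G (x i) + t * (lambda i * expR (lambda i * t) * (g (x i) + M) + K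
        - expR (- ((\sum_j lambda j + N%:R) * t)) * (1 - t)
          * psi x 0 i * g (x i)))%:E)%E.
Proof.
move=> t0 t1 M0 K0 gM gK.
have := queue_drift lambda psi P Arr Srv X lambda_ge0 psi01 mX X0 X_network g M
  g0 M0 gM x t i (ltW t0).
rewrite -/G; set q := expR _; set m := (\int[_]_w _)%E => drift.
have q0 : 0 < q by exact: expR_gt0.
have q1 : q <= 1.
  by rewrite expR_le1 oppr_le0 mulr_ge0 ?(ltW t0)// addr_ge0// sumr_ge0.
have [p0 p1] := psi01 x i.
(* For a nonempty queue this is [gK] multiplied by [1 - t], as [(1 - t) * (1 + t) <= 1]. *)
have gpred : (1 - t) * g (x i) - K <= g (x i).-1.
  case: (x i) => [|n] /=; first by have := g0 0; nra.
  by have := gK n; have := g0 n.+1; have := g0 n; nra.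
have e1 : expR (lambda i * t) - 1 <= lambda i * t * expR (lambda i * t).
  have := expR_ge1Dx (- (lambda i * t)).
  rewrite expRN => H; have E0 := expR_gt0 (lambda i * t).
  have : (1 + - (lambda i * t)) * expR (lambda i * t) <= 1.
    by rewrite -ler_pdivlMr// div1r.
  by lra.
have gM0 : 0 <= g (x i) + M by rewrite addr_ge0.
apply: (@le_trans _ _ ((G (x i) + (g (x i) + M) * (expR (lambda i * t) - 1))%:E
    - (g (x i).-1 * (psi x 0 i * t * q))%:E)%E).
  by rewrite leeBrDr.
rewrite -EFinB lee_fin.
have H1 : (g (x i) + M) * (expR (lambda i * t) - 1)
    <= (g (x i) + M) * (lambda i * t * expR (lambda i * t)) by exact: ler_wpM2l.
have ptq : 0 <= psi x 0 i * t * q by rewrite !mulr_ge0// ltW.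
have H2 : ((1 - t) * g (x i) - K) * (psi x 0 i * t * q)
    <= g (x i).-1 * (psi x 0 i * t * q) by exact: ler_wpM2r.
have H3 : psi x 0 i * t * q * K <= t * K.
  apply: ler_wpM2r => //; rewrite mulrAC -[leRHS]mul1r.
  by apply: ler_wpM2r; [exact: ltW|rewrite mulr_ile1// ltW].
by lra.
Qed.

Lemma skeleton_drift : exists t V b (F : seq (state N)),
  [/\ 0 < t, (forall y, 0 <= V y), 0 <= b
    & forall y, (\int[P y]_w (V (X t w))%:E + 1
                 <= (V y + if y \in F then b else 0)%:E)%E].
Proof.
have /choice [c cP] : forall i, exists c, 0 < c /\ forall mu, 0 <= mu ->
    (h mu <= (fine (h (nu 0%R i)) + c * (mu - nu 0%R i))%:E)%E.
  move=> i; have [c c0 hc] := service_utility_supergradient h _ h_util (nu_gt0 i).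
  by exists c.
have c_gt0 i : 0 < c i by have [] := cP i.
have c_sup x := weighted_service_ge c x (fun i => (cP i).2).
set L := \sum_j lambda j + N%:R.
have [t [t0 t1 tP]] := small_time lambda (fun i => nu 0 i) L lambda_nu.
have [M M0 gM1] := queue_weight_growth g 1 g_weight ltr01.
have gM n : g n.+1 <= 2 * g n + M by exact: gM1.
have [K K0 gK] := queue_weight_growth g t g_weight t0.
set q := expR (- (L * t)) in tP *.
have q0 : 0 < q by exact: expR_gt0.
pose l i := lambda i * expR (lambda i * t).
have l0 i : 0 <= l i by rewrite mulr_ge0// expR_ge0.
(* The margin that [small_time] leaves between service and arrivals. *)
pose e i := q * (1 - t) * nu 0 i - l i.
have e0 i : 0 < e i by rewrite subr_gt0 tP.
pose D := \sum_i c i * (l i * M + K).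
have D0 : 0 <= D.
  by apply: sumr_ge0 => i _; rewrite mulr_ge0 ?(ltW (c_gt0 i))// addr_ge0// mulr_ge0.
(* The factor [1 / t] cancels the length of a step in the drift. *)
pose V x := \sum_i c i / t * G (x i).
have V0 x : 0 <= V x.
  apply: sumr_ge0 => i _; rewrite mulr_ge0 ?cumulative_weight_ge0//.
  by rewrite divr_ge0// ltW.
have drift x : (\int[P x]_w (V (X t w))%:E
    <= (V x + D - \sum_i c i * e i * g (x i))%:E)%E.
  have -> : (\int[P x]_w (V (X t w))%:E
      = \sum_(i < N) (c i / t)%:E * \int[P x]_w (G (X t w i))%:E)%E.
    have mG i : measurable_fun setT (fun w => (G (X t w i))%:E).
      by apply: (@measurable_fun_countable _ _ R _ (X t) _ (fun y => (G (y i))%:E)) => y;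
        apply: mX; exact: ltW.
    have G0 n : 0 <= G n by exact: cumulative_weight_ge0.
    under eq_integral do rewrite /V -sumEFin.
    rewrite ge0_integral_sum//.
    - apply: eq_bigr => i _; under eq_integral do rewrite EFinM.
      by rewrite ge0_integralZl_EFin// ?divr_ge0 ?ltW// => w _; rewrite lee_fin.
    - by move=> i; under eq_fun do rewrite EFinM; exact: measurable_funeM.
    - by move=> i w _; rewrite lee_fin mulr_ge0// divr_ge0// ltW.
  apply: (@le_trans _ _ (\sum_(i < N) (c i / t * (G (x i)
      + t * (l i * (g (x i) + M) + K - q * (1 - t) * psi x 0%R i * g (x i))))%:E)%E).
    apply: lee_sum => i _; rewrite [leRHS]EFinM; apply: lee_wpmul2l.
      by rewrite lee_fin divr_ge0// ltW.
    exact: queue_drift_linear.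
  rewrite sumEFin lee_fin.
  (* The rates [psi x] are exchanged for [nu]; by [c_sup] the correction is nonpositive. *)
  have -> : \sum_(i < N) c i / t * (G (x i) + t * (l i * (g (x i) + M) + K
        - q * (1 - t) * psi x 0 i * g (x i)))
      = V x + D - \sum_i c i * e i * g (x i) +
        q * (1 - t) * (\sum_i g (x i) * c i * nu 0 i
                       - \sum_i g (x i) * c i * psi x 0 i).
    rewrite /V /D -!sumrB mulr_sumr -!big_split -sumrB -big_split/=.
    apply: eq_bigr => i _; rewrite /e; field; exact: lt0r_neq0.
  rewrite gerDl; apply: mulr_ge0_le0; last by rewrite subr_le0.
  by rewrite mulr_ge0 ?(ltW q0)// subr_ge0 ltW.
(* Since [g] is unbounded, a single queue of length at least [B] already outweighs [D + 1]. The
   exceptional set [F] is therefore the finite box of states with all lengths below [B]. *)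
have [B _ BP] : \forall n \near \oo, forall i, D + 1 <= c i * e i * g n.
  apply: filter_forall => i.
  have /cvgryPge/(_ ((D + 1) / (c i * e i))) := g_unbounded.
  by apply: filterS => n; rewrite ler_pdivrMr 1?mulrC// mulr_gt0.
pose F := [seq [ffun i => f i : nat] | f : {ffun 'I_N -> 'I_B}].
exists t, V, (D + 1), F; split => // [|y]; first by rewrite addr_ge0.
apply: le_trans (leeD2r 1%E (drift y)) _.
rewrite -EFinD lee_fin.
have sum0 : 0 <= \sum_i c i * e i * g (y i).
  by apply: sumr_ge0 => i _; rewrite !mulr_ge0// ltW.
case: ifPn => [_|yF]; first by lra.
suff [i yi] : exists i, (B <= y i)%N.
  have : D + 1 <= \sum_i c i * e i * g (y i).
    rewrite (bigD1 i)//= (le_trans (BP _ yi i))// lerDl sumr_ge0// => j _.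
    by rewrite !mulr_ge0// ltW.
  by lra.
apply: contrapT => /forallNP nB; move/negP: yF; apply.
have yB i : (y i < B)%N by rewrite ltnNge; apply/negP.
apply/mapP; exists [ffun i => Ordinal (yB i)]; first by rewrite mem_enum.
by apply/ffunP => i; rewrite !ffunE.
Qed.

End Stability.

(** * From the skeleton chain back to the process *)

Section Skeleton.
Context {R : realType} {d : measure_display} {T : measurableType d} {N : nat}.
Variables (P : state N -> probability T R) (X : R -> T -> state N) (t : R).
Hypothesis t0 : 0 < t.
Local Open Scope ereal_scope.

Definition skeleton (n : nat) (w : T) : state N := X (n%:R * t) w.

(** If [n] is the first index at which [not_returned] fails, the [n] earlier terms add up to
    [n * t], and [X] has returned by that time. If there is no such index, the series is
    infinite. *)
Lemma return_time_le x w :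
  return_time X x w
  <= \sum_(n <oo) t%:E * (\1_(not_returned skeleton x n) w)%:E.
Proof.
set E := not_returned skeleton x.
have term0 n : 0 <= t%:E * (\1_(E n) w)%:E by rewrite mule_ge0 ?lee_fin// ltW.
have partial n : (forall k, (k < n)%N -> E k w) ->
    (n%:R * t)%:E <= \sum_(k <oo) t%:E * (\1_(E k) w)%:E.
  move=> En; apply: (@le_trans _ _ (\sum_(0 <= k < n) t%:E * (\1_(E k) w)%:E)).
    rewrite (eq_big_nat _ _ (F2 := fun=> t%:E)) => [|k /andP[_ kn]].
      by rewrite sumEFin sumr_const_nat subn0 lee_fin mulr_natl.
    by rewrite indicE mem_set ?mule1//; exact: En.
  exact: nneseries_lim_ge.
have [allE|/existsNP ex] := pselect (forall n, E n w).
  rewrite [leRHS](_ : _ = +oo) ?leey//; apply: eq_infty => r.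
  have := archi_boundP (normr_ge0 (r / t)%R).
  move=> /ltW rt; apply: le_trans _ (partial (Num.bound `|r / t|%R) (fun k _ => allE k)).
  by rewrite lee_fin -ler_pdivrMr// (le_trans (ler_norm _)).
have exb : exists n, `[< ~ E n w >] by have [n nE] := ex; exists n; exact/asboolP.
case: (ex_minnP exb) => n /asboolP nE minn.
have En k : (k < n)%N -> E k w.
  by move=> kn; apply: contrapT => /asboolP /minn; rewrite leqNgt kn.
apply: le_trans _ (partial n En).
have [i [j [ij jn Yi Yj]]] : exists i j,
    [/\ (i <= j)%N, (j <= n)%N, skeleton i w <> x & skeleton j w = x].
  apply: contrapT => H; apply: nE => i j ij jn Yi Yj; apply: H.
  by exists i, j.
apply: (@le_trans _ _ (j%:R * t)%:E); last by rewrite lee_fin ler_pM2r// ler_nat.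
apply: ereal_inf_lbound; exists (j%:R * t)%R => //; exists (i%:R * t)%R; split=> //.
  by rewrite mulr_ge0// ltW.
by rewrite ler_pM2r// ler_nat.
Qed.

Lemma return_time_ge0 x w : 0 <= return_time X x w.
Proof.
apply: le_ereal_inf_tmp => _ [s [r [r0 rs _ _]] <-].
by rewrite lee_fin (le_trans r0).
Qed.

Hypothesis X_markov : markov_process P X.

Lemma measurable_skeleton n y : measurable [set w | skeleton n w = y].
Proof.
by have [mX _ _] := X_markov; apply: mX; rewrite mulr_ge0// ltW.
Qed.

Lemma skeleton0 x : {ae P x, forall w, skeleton 0 w = x}.
Proof.
have [_ X0 _] := X_markov; apply: filterS (X0 x) => w.
by rewrite /skeleton mul0r.
Qed.

Lemma skeleton_last x n (c : nat -> state N) z :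
  P x [set w | (forall j, (j <= n)%N -> skeleton j w = c j) /\ skeleton n.+1 w = z]
  = P x [set w | forall j, (j <= n)%N -> skeleton j w = c j]
    * P (c n) [set w | skeleton 1 w = z].
Proof.
have [_ _ XM] := X_markov.
have := XM x n (fun j => (j%:R * t)%R) c t z; rewrite /skeleton mul1r -[in n.+1%:R]natr1.
rewrite mulrDl mul1r; apply; [by rewrite mul0r| |exact: ltW].
by move=> j; rewrite ler_pM2r// ler_nat.
Qed.

Lemma skeleton_first x n z y :
  P x [set w | skeleton 1 w = z /\ skeleton n.+1 w = y]
  = P x [set w | skeleton 1 w = z] * P z [set w | skeleton n w = y].
Proof.
have [_ _ XM] := X_markov.
have := XM x 0%N (fun=> t) (fun=> z) (n%:R * t)%R y (ltW t0) (fun=> lexx _).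
rewrite mulr_ge0 ?(ltW t0)// => /(_ isT).
rewrite /skeleton mul1r -[in n.+1%:R]nat1r mulrDl mul1r.
rewrite (_ : [set w | (forall j, (j <= 0)%N -> X t w = z) /\ _]
           = [set w | X t w = z /\ X (t + n%:R * t)%R w = y]); last first.
  by apply/seteqP; split => w /= [Xz Xy]; split=> //; exact: (Xz 0%N).
rewrite (_ : [set w | forall j, (j <= 0)%N -> X t w = z] = [set w | X t w = z])//.
by apply/seteqP; split => w /= => [/(_ 0%N)|]; exact.
Qed.

(** The time [s] at which [y] is reached need not be a multiple of [t]; from there, being at [y]
    again at a later multiple has positive probability by the idling hypothesis. *)
Lemma skeleton_irreducible :
  irreducible_process P X ->
  (forall x s, (0 <= s)%R -> 0 < P x [set w | X s w = x]) ->
  forall x y, exists n, 0 < P x [set w | skeleton n w = y].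
Proof.
move=> irr idle x y; have [s s0 xy] := irr x y.
have [mX _ XM] := X_markov.
exists (Num.bound (s / t)); set n := Num.bound _.
have sn : (0 <= n%:R * t - s)%R.
  rewrite subr_ge0 -ler_pdivrMr// ltW//; apply: archi_boundP.
  by rewrite divr_ge0// ltW.
have := XM x 0%N (fun=> s) (fun=> y) (n%:R * t - s)%R y s0 (fun=> lexx _) sn.
rewrite addrC subrK.
rewrite (_ : [set w | forall j, (j <= 0)%N -> X s w = y] = [set w | X s w = y]); last first.
  by apply/seteqP; split => w /= => [/(_ 0%N)|]; exact.
rewrite (_ : [set w | (forall j, (j <= 0)%N -> X s w = y) /\ _]
           = [set w | X s w = y] `&` [set w | skeleton n w = y]); last first.
  by apply/seteqP; split => w /= [Xz Xy]; split=> //; exact: (Xz 0%N).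
move=> E; apply: (@lt_le_trans _ _
    (P x ([set w | X s w = y] `&` [set w | skeleton n w = y]))).
  by rewrite E mule_gt0// idle.
apply: le_measure; rewrite ?inE; last exact: subIsetr.
  by apply: measurableI; [exact: mX|exact: measurable_skeleton].
exact: measurable_skeleton.
Qed.

Lemma integrable_return_time x :
  \sum_(n <oo) P x (not_returned skeleton x n) < +oo ->
  \int[P x]_w return_time X x w < +oo.
Proof.
move=> sum_fin; have mE n : measurable (not_returned skeleton x n).
  exact: (measurable_not_returned _ measurable_skeleton).
apply: (@le_lt_trans _ _ (\int[P x]_w
    \sum_(n <oo) t%:E * (\1_(not_returned skeleton x n) w)%:E)).
  apply: ge0_le_integral_nonmeas.
  - by move=> w _; exact: return_time_ge0.
  - by move=> w _; apply: nneseries_ge0 => n _ _; rewrite mule_ge0 ?lee_fin// ltW.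
  - by move=> w _; split=> //; exact: return_time_le.
have mI n : measurable_fun setT
    (fun w => (\1_(not_returned skeleton x n) w)%:E : \bar R).
  by apply/measurable_EFinP; exact: measurable_indic.
rewrite integral_nneseries//; last 2 first.
- by move=> n; exact: measurable_funeM.
- by move=> n w _; rewrite mule_ge0 ?lee_fin// ltW.
under eq_eseriesr => n _.
  rewrite ge0_integralZl_EFin// ?ltW// integral_indic// setIT.
  over.
rewrite nneseriesZl//; have : 0 <= \sum_(n <oo) P x (not_returned skeleton x n).
  exact: nneseries_ge0.
case: (limn _) sum_fin => [r _ _|//|//].
by rewrite -EFinM ltry.
Qed.

End Skeleton.

Theorem theorem11 (R : realType) (d : measure_display) (T : measurableType d)
    (N : nat) (N_gt0 : (0 < N)%N)
    (lambda : 'I_N -> R) (C : set 'rV[R]_N)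
    (g : nat -> R) (h : R -> \bar R) (psi : state N -> 'rV[R]_N)
    (P : state N -> probability T R) (Arr Srv : 'I_N -> R -> T -> nat)
    (X : R -> T -> state N)
    (lambda_ge0 : forall i, 0 <= lambda i)
    (C_compact : compact C) (C_cc : coordinate_convex C)
    (h_util : service_utility h) (g_weight : queue_weight g)
    (g_unbounded : g @ \oo --> +oo)
    (psi_max : utility_maximising C g h psi)
    (X_network : queueing_network lambda psi P Arr Srv X)
    (X_markov : markov_process P X)
    (X_irr : irreducible_process P X)
    (stab : exists nu, C nu /\ forall i, lambda i < nu 0 i) :
  positive_recurrent P X.
Proof.
have [nu [Cnu lambda_nu]] := stab.
have [t [V [b [F [t0 V0 b0 drift]]]]] := skeleton_drift lambda C g h psi P Arr
  Srv X lambda_ge0 h_util g_weight g_unbounded psi_max X_network X_markov nu Cnu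
  lambda_nu.
have [mX X0 _] := X_markov.
have psi01 x i : 0 <= psi x 0 i /\ psi x 0 i <= 1 by have [] := psi_max x.
have idle x s : 0 <= s -> (0 < P x [set w | X s w = x])%E.
  exact: (idle_gt0 lambda psi P Arr Srv X).
have irr := skeleton_irreducible P X t t0 X_markov X_irr idle.
move=> x; apply: (integrable_return_time P X t t0 X_markov).
(* A state other than [x], as [0 < N]; the chain must be able to leave [x] for the mean waiting time
   there to be finite. *)
pose x' : state N := [ffun i => (x i).+1].
have x'x : x' != x.
  apply/eqP => /ffunP /(_ (Ordinal N_gt0)); rewrite ffunE => /eqP.
  by rewrite eqn_leq ltnn.
apply: (foster P (skeleton X t) (measurable_skeleton P X t t0 X_markov)
  (skeleton0 P X t X_markov) (skeleton_last P X t t0 X_markov)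
  (skeleton_first P X t t0 X_markov) x x' V b F x'x) => // y.
by move: (drift y); rewrite /step /skeleton mul1r.
Qed.
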